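(* Let $n\ge 1$ and let $\underline{k}=(k_1,\ldots,k_n),\ \underline{m}=(m_1,\ldots,m_n)\in\mathbb{N}^n$ be such that for every $i\in\{1,\ldots,n\}$, $k_i\geq 5$ and $1\leq m_i\leq\sqrt{k_i}$. Then for every non-empty union-closed family $\mathcal{F}\subseteq 2^{[n]}$ with $\mathcal{F}\neq\{\emptyset\}$, there is an $i\in\bigcup_{A\in\mathcal{F}}A$ such that \[\frac{\sum_{A\in\mathcal{F}:\,i\in A}\ \prod_{j\in A}\frac{k_j}{m_j}}{\sum_{A\in\mathcal{F}}\ \prod_{j\in A}\frac{k_j}{m_j}}\geq\frac{1}{2}.\]
   Context: $\mathbb{N}$ denotes the positive integers, $[n]=\{1,\ldots,n\}$, and $2^{[n]}$ is the set of all subsets of $[n]$. A family $\mathcal{F}$ of sets is union-closed if $A\cup B\in\mathcal{F}$ for all $A,B\in\mathcal{F}$. An empty product equals $1$. *)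

(* Defs.v *)
From mathcomp Require Import all_boot all_order all_algebra.
Set Implicit Arguments.
Unset Strict Implicit.
Unset Printing Implicit Defensive.

(* Subsets of [n] are represented as sets of ordinals, i.e. with the index
   shift {1, ..., n} ~ 'I_n = {0, ..., n-1}. *)
Definition union_closed (n : nat) (F : {set {set 'I_n}}) : Prop :=
  forall A B : {set 'I_n}, A \in F -> B \in F -> A :|: B \in F.

(* Main.v *)
(* Entropy method. Let [w] be the product weight on the family, [Z] its mass, and
   let A, B be independent with law [w / Z]. Since A :|: B stays in the family and
   [w / Z] maximizes entropy plus mean logarithmic weight, passing from A to A :|: B
   cannot increase this quantity. For a coordinate missed with probability t, it
   gains ln (x i) * t (1 - t) of weight; its conditional entropy is multiplied by at
   least 10/7 t, because h(tu) >= 5/7 (t h(u) + u h(t)) for the binary entropy h. If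
   every element had frequency < 1/2, i.e. t > 1/2, these changes would add up to a
   strict gain as soon as x i >= sqrt 5. Logarithms need real numbers whereas the
   statement concerns a real closed field; the inequality is one between rational
   numbers, so it is proved over the reals and transferred. *)
Require Import Defs.
From mathcomp Require Import all_boot all_order all_algebra.
From mathcomp Require Import ring lra.
From mathcomp Require Import boolp reals Rstruct normedtype derive realfun exp.
Set Implicit Arguments.
Unset Strict Implicit.
Unset Printing Implicit Defensive.
Import Order.TTheory GRing.Theory Num.Theory numFieldNormedType.Exports.
Local Open Scope ring_scope.

(** * Inequalities for the logarithm and the binary entropy *)

Lemma ln_1subr_le (R : realType) (y : R) :
  0 <= y < 1 -> y + y ^+ 2 / 2 <= - ln (1 - y).
Proof.
case/andP=> y0 y1.
pose f (x : R) := - ln (1 - x) - (x + x ^+ 2 / 2).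
have df (x : R) : x < 1 -> is_derive x (1:R) f ((1 - x)^-1 - (1 + x)).
  move=> x1.
  have h : 0 < 1 - x by rewrite subr_gt0.
  have dl : is_derive x (1 : R) (@ln R \o (fun z => 1 - z)) (- (1 - x)^-1).
    apply: is_derive_eq; first by apply: is_derive1_comp; exact: is_derive1_ln.
    by rewrite /GRing.scale /=; ring.
  rewrite /f; apply: is_derive_eq.
  by rewrite /GRing.scale/=; field; lra.
suff : f 0 <= f y by rewrite /f !subr0 ln1; lra.
apply: (@ger0_derive1_ndecr _ f 0 y) => //.
- by move=> x /[!in_itv]/= /andP[_ xy]; have [] := df x (lt_trans xy y1).
- move=> x /[!in_itv]/= /andP[x0 xy].
  rewrite derive1E (@derive_val _ _ _ _ _ _ _ (df x (lt_trans xy y1))).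
  have h : 0 < 1 - x by lra.
  (* The derivative is nonnegative because [(1 + x) * (1 - x) <= 1]. *)
  rewrite subr_ge0 -[_^-1]mul1r ler_pdivlMr//; nra.
- apply: derivable_within_continuous => x /[!in_itv]/= /andP[x0 xy].
  by have [] := df x (le_lt_trans xy y1).
Qed.

Section BinaryEntropy.
Variable R : realType.
Implicit Types x y s : R.

Definition xlnx_neg x : R := - (x * ln x).

(** For nonnegative arguments this is [(x + y) * h (x / (x + y))], with [h] the binary entropy in
    nats: a form homogeneous of degree 1, suited to measures that are not normalized. *)
Definition split_entropy x y : R := xlnx_neg x + xlnx_neg y - xlnx_neg (x + y).

(** This is [ln u <= u - 1] at [u = y / (x * s)]. The parameter [s] is the point where the tangent
    to the logarithm is taken; one common [s] for several terms yields Jensen's inequality. *)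
Lemma mul_ln_ratio_le x y s : 0 <= x -> 0 <= y -> (y = 0 -> x = 0) -> 0 < s ->
  x * (ln y - ln x) <= x * ln s + y / s - x.
Proof.
move=> x0 y0 yx s0; have [->|xN0] := eqVneq x 0.
  by rewrite !mul0r add0r subr0 divr_ge0// ltW.
have {}x0 : 0 < x by rewrite lt_neqAle eq_sym xN0.
have {}y0 : 0 < y.
  by rewrite lt_neqAle y0 andbT eq_sym; apply: contra_neq xN0.
have h : ln (y / (x * s)) <= y / (x * s) - 1.
  have -> : y / (x * s) = 1 + (y / (x * s) - 1) by ring.
  rewrite [leRHS]addrAC subrr add0r; apply: le_ln1Dx.
  by rewrite ltrBrDl subrr divr_gt0 ?mulr_gt0.
move: h; rewrite ln_div ?posrE ?mulr_gt0// lnM ?posrE//.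
move=> /(ler_wpM2l (ltW x0)).
have -> : x * (y / (x * s) - 1) = y / s - x by field; rewrite !gt_eqF.
by lra.
Qed.

(** The log-sum inequality. The tangent is taken at the overall ratio [G / F], where the linear
    terms cancel after summation. *)
Lemma sum_mul_ln_ratio_le (I : finType) (f g : I -> R) :
  (forall i, 0 <= f i) -> (forall i, 0 <= g i) -> (forall i, g i = 0 -> f i = 0) ->
  \sum_i f i * (ln (g i) - ln (f i))
    <= (\sum_i f i) * (ln (\sum_i g i) - ln (\sum_i f i)).
Proof.
move=> f0 g0 gf; set F := \sum_i f i; set G := \sum_i g i.
have [F0|FN0] := eqVneq F 0.
  rewrite F0 mul0r big1// => i _.
  have := psumr_eq0P (fun i _ => f0 i) F0 => /(_ i isT) ->.
  by rewrite mul0r.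
have Fp : 0 < F by rewrite lt_neqAle eq_sym FN0 sumr_ge0.
have Gp : 0 < G.
  rewrite lt_neqAle eq_sym sumr_ge0// andbT; apply: contra_neq FN0 => G0.
  by rewrite /F big1// => i _; apply: gf; apply: (psumr_eq0P (fun i _ => g0 i) G0).
have s0 : 0 < G / F by rewrite divr_gt0.
apply: le_trans (_ : \sum_i (f i * ln (G / F) + g i / (G / F) - f i) <= _).
  by apply: ler_sum => i _; apply: mul_ln_ratio_le => //; exact: gf.
rewrite sumrB big_split/= -!mulr_suml -/F -/G ln_div ?posrE//.
have -> : G / (G / F) = F by field; rewrite !gt_eqF.
by rewrite addrK.
Qed.

Lemma split_entropyE x y : split_entropy x y =
  x * (ln (x + y) - ln x) + y * (ln (x + y) - ln y).
Proof. by rewrite /split_entropy /xlnx_neg; ring. Qed.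

Lemma split_entropyC x y : split_entropy x y = split_entropy y x.
Proof. by rewrite /split_entropy [y + x]addrC [_ y + _]addrC. Qed.

Lemma split_entropy0 y : split_entropy 0 y = 0.
Proof. by rewrite split_entropyE mul0r !add0r subrr mulr0. Qed.

(** Homogeneous form of [h(t) >= 5/2 t (1 - t)]. Both logarithms are bounded by [ln_1subr_le]: the
    linear terms contribute 2 to the constant, the quadratic ones 1/2. *)
Lemma split_entropy_ge x y : 0 <= x -> 0 <= y ->
  5 / 2 * (x * y) <= (x + y) * split_entropy x y.
Proof.
move=> x0 y0; have [->|xN0] := eqVneq x 0.
  by rewrite split_entropy0 mul0r !mulr0.
have [->|yN0] := eqVneq y 0.
  by rewrite split_entropyC split_entropy0 !mulr0.
have {}x0 : 0 < x by rewrite lt_neqAle eq_sym xN0.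
have {}y0 : 0 < y by rewrite lt_neqAle eq_sym yN0.
have s0 : 0 < x + y by rewrite addr_gt0.
have H (u v : R) : 0 < u -> 0 < v ->
    v / (u + v) + (v / (u + v)) ^+ 2 / 2 <= ln (u + v) - ln u.
  move=> u0 v0; have uv0 : 0 < u + v by rewrite addr_gt0.
  have := @ln_1subr_le R (v / (u + v)).
  have -> : 1 - v / (u + v) = u / (u + v) by field; rewrite gt_eqF.
  rewrite ln_div ?posrE// opprB; apply.
  by rewrite divr_ge0 ?ltW//= ltr_pdivrMr// mul1r ltrDr.
rewrite split_entropyE.
have := ler_wpM2l (ltW x0) (H _ _ x0 y0).
have := ler_wpM2l (ltW y0) (H _ _ y0 x0).
rewrite [y + x]addrC => h1 h2.
apply: le_trans (ler_wpM2l (ltW s0) (lerD h2 h1)).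
rewrite le_eqVlt; apply/orP; left; apply/eqP; field.
by rewrite gt_eqF.
Qed.

Lemma split_entropy_ge0 x y : 0 <= x -> 0 <= y -> 0 <= split_entropy x y.
Proof.
move=> x0 y0; have := split_entropy_ge x0 y0 => h.
have [s0|sN0] := eqVneq (x + y) 0.
  have -> : x = 0 by lra.
  by rewrite split_entropy0.
rewrite -(@pmulr_rge0 _ (x + y)); last by rewrite lt_neqAle eq_sym sN0 addr_ge0.
by apply: le_trans h; have := mulr_ge0 x0 y0; lra.
Qed.

Lemma split_entropy_le x y : 0 <= x -> 0 <= y ->
  split_entropy x y <= (x + y) * ln 2.
Proof.
move=> x0 y0; rewrite split_entropyE.
have h1 := @mul_ln_ratio_le x (x + y) 2 x0 (addr_ge0 x0 y0)
  ltac:(move=> ?; lra) ltac:(lra).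
have h2 := @mul_ln_ratio_le y (x + y) 2 y0 (addr_ge0 x0 y0)
  ltac:(move=> ?; lra) ltac:(lra).
lra.
Qed.

(* With t = p / (p + q) and u = r / (r + s), this is the homogeneous form of
   h(tu) >= 5/7 (t h(u) + u h(t)). *)
Lemma split_entropy_or p q r s : 0 <= p -> 0 <= q -> 0 <= r -> 0 <= s ->
  5 / 7 * (p * split_entropy r s + r * split_entropy p q)
    <= split_entropy (p * r) (p * s + q * r + q * s).
Proof.
move=> p0 q0 r0 s0.
set X := p * s + q * r + q * s; set N := (p + q) * (r + s).
have X0 : 0 <= X by rewrite !addr_ge0 ?mulr_ge0.
have [pE|pN0] := eqVneq p 0.
  by rewrite /X pE split_entropy0 !mul0r mulr0 addr0 mulr0 split_entropy0.
have [rE|rN0] := eqVneq r 0.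
  by rewrite /X rE split_entropy0 !mul0r !mulr0 addr0 mulr0 split_entropy0.
have {}p0 : 0 < p by rewrite lt_neqAle eq_sym pN0.
have {}r0 : 0 < r by rewrite lt_neqAle eq_sym rN0.
have [XE|XN0] := eqVneq X 0.
  have hs : s = 0.
    have : p * s = 0 by have := mulr_ge0 (ltW p0) s0; have := mulr_ge0 q0 (ltW r0);
      have := mulr_ge0 q0 s0; rewrite /X in XE; lra.
    by move/eqP; rewrite mulf_eq0 gt_eqF//= => /eqP.
  have hq : q = 0.
    have : q * r = 0 by have := mulr_ge0 (ltW p0) s0; have := mulr_ge0 q0 (ltW r0);
      have := mulr_ge0 q0 s0; rewrite /X in XE; lra.
    by move/eqP; rewrite mulf_eq0 [r == 0]gt_eqF//= orbF => /eqP.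
  rewrite XE hs hq ![split_entropy _ 0]split_entropyC.
  by rewrite !split_entropy0 !mulr0 addr0 mulr0.
have {}X0 : 0 < X by rewrite lt_neqAle eq_sym XN0.
have pr0 : 0 < p * r by rewrite mulr_gt0.
have NE : N = p * r + X by rewrite /N /X; ring.
have N0 : 0 < N by rewrite NE addr_gt0.
(* [z] is the mean of the ratios [(r + s) / s], [(p + q) / q] and [1] with weights [p * s], [q * r]
   and [q * s], of sum [X]. Tangents at [z] give Jensen's inequality. *)
pose z := (N + p * r) / X.
have z0 : 0 < z by rewrite divr_gt0// addr_gt0.
have h1 := ler_wpM2l (ltW p0)
  (@mul_ln_ratio_le s (r + s) z s0 (addr_ge0 (ltW r0) s0) ltac:(move=> ?; lra) z0).
have h2 := ler_wpM2l (ltW r0)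
  (@mul_ln_ratio_le q (p + q) z q0 (addr_ge0 (ltW p0) q0) ltac:(move=> ?; lra) z0).
have h3 := ler_wpM2l (mulr_ge0 q0 s0)
  (@mul_ln_ratio_le 1 1 z ler01 ler01 id z0).
have lnz : ln z <= ln N - ln X + p * r / N.
  have q0' : 0 < p * r / N by rewrite divr_gt0.
  have z1 : 0 < 1 + p * r / N by rewrite addr_gt0.
  have : ln (1 + p * r / N) <= p * r / N by apply: le_ln1Dx; lra.
  have -> : z = N * (1 + p * r / N) / X by rewrite /z; field; rewrite !gt_eqF.
  by rewrite ln_div ?posrE ?(mulr_gt0 N0 z1)// lnM ?posrE//; lra.
have hz : p * (r + s) / z + r * (p + q) / z + q * s / z = X.
  by rewrite -!mulrDl /z; rewrite /X /N in X0 N0 *; field; rewrite !gt_eqF// addr_gt0.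
have jensen : p * (s * (ln (r + s) - ln s)) + r * (q * (ln (p + q) - ln q))
    <= X * ln z.
  have -> : X * ln z = p * (s * ln z) + r * (q * ln z) + q * s * ln z.
    by rewrite /X; ring.
  have XE : X = p * s + q * r + q * s by [].
  rewrite subrr mulr0 in h3; lra.
have h4 := split_entropy_ge (ltW pr0) (ltW X0).
rewrite -NE in h4.
(* Replacing [ln z] by [ln N - ln X] costs at most 2/5 of [split_entropy (p * r) X], whence the
   constant [5 / 7 = 1 / (1 + 2 / 5)]. *)
have h5 : X * (p * r / N) <= 2 / 5 * split_entropy (p * r) X.
  rewrite mulrA ler_pdivrMr//; lra.
have h6 : X * ln z <= X * (ln N - ln X) + X * (p * r / N).
  by rewrite -mulrDr; apply: ler_wpM2l => //; exact: ltW.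
have lnpr : ln (p * r) = ln p + ln r by rewrite lnM ?posrE.
have lnN : ln N = ln (p + q) + ln (r + s) by rewrite lnM ?posrE ?ltr_wpDr.
have E1 : split_entropy (p * r) X = p * r * (ln N - ln p - ln r) + X * (ln N - ln X).
  by rewrite split_entropyE -NE lnpr; ring.
have E2 : p * split_entropy r s + r * split_entropy p q =
    p * r * (ln N - ln p - ln r)
     + (p * (s * (ln (r + s) - ln s)) + r * (q * (ln (p + q) - ln q))).
  by rewrite !split_entropyE lnN; ring.
rewrite E2; lra.
Qed.

End BinaryEntropy.

(** * Subsets of an (n+1)-element set as a first bit and a subset of the rest, for induction on
    [n] *)

Section ConsSet.
Variable n : nat.
Implicit Types A B : {set 'I_n}.

Definition cons_set (b : bool) A : {set 'I_n.+1} :=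
  [set i | if unlift ord0 i is Some j then j \in A else b].

Definition tail_set (A : {set 'I_n.+1}) : {set 'I_n} :=
  [set j | lift ord0 j \in A].

Lemma in_cons_set0 b A : (ord0 \in cons_set b A) = b.
Proof. by rewrite inE unlift_none. Qed.

Lemma in_cons_setS b A j : (lift ord0 j \in cons_set b A) = (j \in A).
Proof. by rewrite inE liftK. Qed.

Lemma cons_setK b A : tail_set (cons_set b A) = A.
Proof. by apply/setP=> j; rewrite inE in_cons_setS. Qed.

Lemma cons_tail_set (A : {set 'I_n.+1}) : cons_set (ord0 \in A) (tail_set A) = A.
Proof.
by apply/setP=> i; case: (unliftP ord0 i) => [j|] ->;
  rewrite ?in_cons_setS ?in_cons_set0 ?inE.
Qed.

Lemma cons_setU a b A B :
  cons_set a A :|: cons_set b B = cons_set (a || b) (A :|: B).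
Proof.
by apply/setP=> i; case: (unliftP ord0 i) => [j|] ->;
  rewrite inE ?in_cons_setS ?in_cons_set0 ?inE.
Qed.

Lemma eq_cons_set a b A B : (cons_set a A == cons_set b B) = (a == b) && (A == B).
Proof.
apply/eqP/andP => [E|[/eqP-> /eqP->]//]; split; apply/eqP.
  by rewrite -(in_cons_set0 a A) E in_cons_set0.
by rewrite -(cons_setK a A) E cons_setK.
Qed.

Lemma sum_cons_set (V : nmodType) (F : {set 'I_n.+1} -> V) :
  \sum_A F A = \sum_A F (cons_set true A) + \sum_A F (cons_set false A).
Proof.
rewrite (reindex (fun p : bool * {set 'I_n} => cons_set p.1 p.2)); last first.
  exists (fun A : {set 'I_n.+1} => (ord0 \in A, tail_set A)) => [[b A] _|A _] /=.
    by rewrite in_cons_set0 cons_setK.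
  by rewrite cons_tail_set.
by rewrite -(pair_big xpredT xpredT (fun b A => F (cons_set b A))) big_bool.
Qed.

End ConsSet.

(** * Entropy of measures on subsets, and convolution under union *)

Section UnionConvolution.
Variable R : realType.

Definition mass n (f : {set 'I_n} -> R) : R := \sum_A f A.

Definition avoid n (f : {set 'I_n} -> R) (i : 'I_n) : R :=
  \sum_(A : {set 'I_n} | i \notin A) f A.

Definition slice n (f : {set 'I_n.+1} -> R) (b : bool) : {set 'I_n} -> R :=
  fun A => f (cons_set b A).

(** Up to normalization, the law of the union of two independent sets with laws [f] and [g]. *)
Definition union_conv n (f g : {set 'I_n} -> R) : {set 'I_n} -> R :=
  fun C => \sum_A \sum_(B | A :|: B == C) f A * g B.

(* The measures are not normalized: this is the mass of [f] times the entropy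
   of the probability [f / mass f]. *)
Definition entropy n (f : {set 'I_n} -> R) : R :=
  \sum_A xlnx_neg (f A) - xlnx_neg (mass f).

(* The conditional entropy of the bit [i \in A] given the bits [j \in A] for
   [j < i]. *)
Fixpoint coord_entropy n (i : nat) : ({set 'I_n} -> R) -> R :=
  if n is n'.+1 then fun f =>
    if i is i'.+1 then
      coord_entropy i' (slice f false) + coord_entropy i' (slice f true)
    else split_entropy (mass (slice f false)) (mass (slice f true))
  else fun _ => 0.

Lemma mass_slice n (f : {set 'I_n.+1} -> R) :
  mass f = mass (slice f false) + mass (slice f true).
Proof. by rewrite /mass sum_cons_set addrC. Qed.

Lemma avoid_ord0 n (f : {set 'I_n.+1} -> R) : avoid f ord0 = mass (slice f false).
Proof.
rewrite /avoid /mass big_mkcond sum_cons_set big1 ?add0r => [|A _].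
  by apply: eq_bigr => A _; rewrite in_cons_set0.
by rewrite in_cons_set0.
Qed.

Lemma avoid_lift n (f : {set 'I_n.+1} -> R) i :
  avoid f (lift ord0 i) = avoid (slice f false) i + avoid (slice f true) i.
Proof.
rewrite /avoid big_mkcond sum_cons_set addrC.
rewrite [X in _ = X + _]big_mkcond [X in _ = _ + X]big_mkcond.
by congr (_ + _); apply: eq_bigr => A _; rewrite in_cons_setS.
Qed.

Lemma mass_ge0 n (f : {set 'I_n} -> R) : (forall A, 0 <= f A) -> 0 <= mass f.
Proof. by move=> f0; apply: sumr_ge0. Qed.

Lemma avoid_ge0 n (f : {set 'I_n} -> R) i : (forall A, 0 <= f A) -> 0 <= avoid f i.
Proof. by move=> f0; apply: sumr_ge0. Qed.

(** Chain rule: entropy of the first bit, plus entropy of the rest given that bit. *)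
Lemma entropy_slice n (f : {set 'I_n.+1} -> R) :
  entropy f = split_entropy (mass (slice f false)) (mass (slice f true))
    + (entropy (slice f false) + entropy (slice f true)).
Proof.
by rewrite /entropy mass_slice sum_cons_set /split_entropy /slice; ring.
Qed.

Lemma entropy_ord0 (f : {set 'I_0} -> R) : entropy f = 0.
Proof.
have E (g : {set 'I_0} -> R) : \sum_A g A = g set0.
  rewrite (bigD1 set0)//= big1 ?addr0// => A /negP[].
  by apply/eqP/setP; case.
by rewrite /entropy /mass !E subrr.
Qed.

Lemma entropy_coord n (f : {set 'I_n} -> R) :
  entropy f = \sum_(i < n) coord_entropy i f.
Proof.
elim: n f => [|n IHn] f; first by rewrite entropy_ord0 big_ord0.
by rewrite big_ord_recl entropy_slice !IHn -big_split.
Qed.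

Lemma coord_entropy_ge0 n i (f : {set 'I_n} -> R) :
  (forall A, 0 <= f A) -> 0 <= coord_entropy i f.
Proof.
elim: n i f => [|n IHn] [|i] f f0 //=.
  by apply: split_entropy_ge0; apply: mass_ge0 => A; apply: f0.
by apply: addr_ge0; apply: IHn => A; apply: f0.
Qed.

Lemma coord_entropy_le n i (f : {set 'I_n} -> R) :
  (forall A, 0 <= f A) -> coord_entropy i f <= mass f * ln 2.
Proof.
elim: n i f => [|n IHn] i f f0.
  by rewrite mulr_ge0 ?mass_ge0// ln_ge0// ler1n.
rewrite mass_slice; case: i => [|i] /=.
  by apply: split_entropy_le; apply: mass_ge0 => A; apply: f0.
by rewrite mulrDl lerD// IHn// => A; apply: f0.
Qed.

(** Concavity of entropy in homogeneous form, from the log-sum inequality for [f] and for [g]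
    against their sum. *)
Lemma entropyD n (f g : {set 'I_n} -> R) :
  (forall A, 0 <= f A) -> (forall A, 0 <= g A) ->
  entropy f + entropy g <= entropy (fun A => f A + g A).
Proof.
move=> f0 g0.
have fg0 A : 0 <= f A + g A by rewrite addr_ge0.
have h1 := sum_mul_ln_ratio_le f0 fg0.
have h2 := sum_mul_ln_ratio_le g0 fg0.
have {}h1 := h1 ltac:(by move=> A; have := f0 A; have := g0 A; lra).
have {}h2 := h2 ltac:(by move=> A; have := f0 A; have := g0 A; lra).
rewrite /entropy /mass /xlnx_neg; rewrite big_split/= in h1 h2 *.
set F := \sum_A f A in h1 h2 *; set G := \sum_A g A in h1 h2 *.
have E : \sum_A - ((f A + g A) * ln (f A + g A)) =
  \sum_A - (f A * ln (f A)) + \sum_A - (g A * ln (g A))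
   - \sum_A f A * (ln (f A + g A) - ln (f A))
   - \sum_A g A * (ln (f A + g A) - ln (g A)).
  by rewrite -big_split -!sumrB/=; apply: eq_bigr => A _; ring.
rewrite E; lra.
Qed.

Lemma union_conv_ge0 n (f g : {set 'I_n} -> R) :
  (forall A, 0 <= f A) -> (forall A, 0 <= g A) -> forall C, 0 <= union_conv f g C.
Proof. by move=> f0 g0 C; do 2!apply: sumr_ge0 => ? _; rewrite mulr_ge0. Qed.

Lemma sum_union_conv n (f g : {set 'I_n} -> R) (P : pred {set 'I_n}) :
  \sum_(C | P C) union_conv f g C = \sum_A \sum_(B | P (A :|: B)) f A * g B.
Proof.
rewrite /union_conv exchange_big; apply: eq_bigr => A _ /=.
rewrite (exchange_big_dep (fun B => P (A :|: B)))/=; last first.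
  by move=> C B PC /eqP->.
apply: eq_bigr => B PAB; rewrite (big_pred1 (A :|: B))// => C /=.
by rewrite eq_sym; apply/andb_idl => /eqP->.
Qed.

Lemma mass_union_conv n (f g : {set 'I_n} -> R) :
  mass (union_conv f g) = mass f * mass g.
Proof. by rewrite /mass sum_union_conv big_distrlr. Qed.

(** A union misses [i] exactly when both sets do, and the two sets are independent. *)
Lemma avoid_union_conv n (f g : {set 'I_n} -> R) i :
  avoid (union_conv f g) i = avoid f i * avoid g i.
Proof.
rewrite /avoid sum_union_conv big_distrlr/= [RHS]big_mkcond.
apply: eq_bigr => A _; case: ifP => iA.
  by apply: eq_bigl => B; rewrite inE negb_or iA.
by rewrite big_pred0// => B; rewrite inE negb_or iA.
Qed.

Lemma slice_union_conv_false n (f g : {set 'I_n.+1} -> R) :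
  slice (union_conv f g) false = union_conv (slice f false) (slice g false).
Proof.
apply: funext => C; rewrite /slice /union_conv sum_cons_set big1 ?add0r => [|A _].
  apply: eq_bigr => A _; rewrite big_mkcond sum_cons_set big1 ?add0r => [|B _].
    by rewrite [RHS]big_mkcond; apply: eq_bigr => B _; rewrite cons_setU eq_cons_set.
  by rewrite cons_setU eq_cons_set.
by rewrite big_mkcond sum_cons_set !big1 ?addr0// => B _; rewrite cons_setU eq_cons_set.
Qed.

Lemma slice_union_conv_true n (f g : {set 'I_n.+1} -> R) :
  slice (union_conv f g) true = fun C =>
    union_conv (slice f true) (slice g true) C +
    (union_conv (slice f true) (slice g false) C +
     union_conv (slice f false) (slice g true) C).
Proof.
apply: funext => C; rewrite /slice /union_conv sum_cons_set addrA.
rewrite -[X in _ = X + _]big_split/=.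
congr (_ + _); apply: eq_bigr => A _.
  rewrite big_mkcond sum_cons_set [X in _ = X + _]big_mkcond [X in _ = _ + X]big_mkcond.
  by congr (_ + _); apply: eq_bigr => B _; rewrite cons_setU eq_cons_set.
rewrite big_mkcond sum_cons_set [in RHS]big_mkcond [X in _ + X]big1 ?addr0.
  by apply: eq_bigr => B _; rewrite cons_setU eq_cons_set.
by move=> B _; rewrite cons_setU eq_cons_set.
Qed.

(** Induction on [n], with two measures because slices for different bits get convolved. The first
    coordinate is [split_entropy_or]. For the others, conditioning on both first bits instead of
    their disjunction only lowers the entropy ([entropyD]), and the induction hypothesis applies to
    each of the four pairs of slices. *)
Lemma entropy_union_conv_ge n (f g : {set 'I_n} -> R) :
  (forall A, 0 <= f A) -> (forall A, 0 <= g A) ->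
  5 / 7 * \sum_(i < n) (avoid f i * coord_entropy i g + avoid g i * coord_entropy i f)
    <= entropy (union_conv f g).
Proof.
elim: n f g => [|n IHn] f g f0 g0; first by rewrite big_ord0 mulr0 entropy_ord0.
have sf0 b A : 0 <= slice f b A by apply: f0.
have sg0 b A : 0 <= slice g b A by apply: g0.
have c0 a b := union_conv_ge0 (sf0 a) (sg0 b).
rewrite entropy_slice slice_union_conv_false slice_union_conv_true mass_union_conv.
have h1 := entropyD (c0 true false) (c0 false true).
have h2 := entropyD (c0 true true)
  (fun A => addr_ge0 (c0 true false A) (c0 false true A)).
have h a b := IHn _ _ (sf0 a) (sg0 b).
have h3 := split_entropy_or (mass_ge0 (sf0 false)) (mass_ge0 (sf0 true))
  (mass_ge0 (sg0 false)) (mass_ge0 (sg0 true)).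
rewrite big_ord_recl !avoid_ord0 /=.
set S := \sum_(i < n) _.
(* Past the first coordinate, [avoid] and [coord_entropy] are both additive over slices, so the sum
   splits exactly along the four pairs. *)
have SE : S = \sum_(i < n) (avoid (slice f false) i * coord_entropy i (slice g false)
       + avoid (slice g false) i * coord_entropy i (slice f false))
     + \sum_(i < n) (avoid (slice f false) i * coord_entropy i (slice g true)
       + avoid (slice g true) i * coord_entropy i (slice f false))
     + \sum_(i < n) (avoid (slice f true) i * coord_entropy i (slice g false)
       + avoid (slice g false) i * coord_entropy i (slice f true))
     + \sum_(i < n) (avoid (slice f true) i * coord_entropy i (slice g true)
       + avoid (slice g true) i * coord_entropy i (slice f true)).
  rewrite -!big_split; apply: eq_bigr => i _ /=.
  by rewrite !avoid_lift; ring.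
have mE : mass (fun C => union_conv (slice f true) (slice g true) C +
    (union_conv (slice f true) (slice g false) C +
     union_conv (slice f false) (slice g true) C)) =
   mass (slice f false) * mass (slice g true) +
   mass (slice f true) * mass (slice g false) +
   mass (slice f true) * mass (slice g true).
  by rewrite -!mass_union_conv /mass !big_split /=; ring.
rewrite mE SE.
have := h false false; have := h false true; have := h true false; have := h true true.
lra.
Qed.

End UnionConvolution.

(** * Auxiliary sums and the gain of a single coordinate *)

Lemma ln_prod (R : realType) (I : finType) (P : pred I) (x : I -> R) :
  (forall i, 0 < x i) -> ln (\prod_(i | P i) x i) = \sum_(i | P i) ln (x i).
Proof.
move=> x0; suff [] : 0 < \prod_(i | P i) x i /\
  ln (\prod_(i | P i) x i) = \sum_(i | P i) ln (x i) by [].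
elim/big_rec2: _ => [|i y z _ [z0 <-]]; first by rewrite ln1.
by rewrite mulr_gt0// lnM ?posrE.
Qed.

Lemma sum_subr_avoid (R : realType) n (f : {set 'I_n} -> R) i :
  mass f - avoid f i = \sum_(A : {set 'I_n} | i \in A) f A.
Proof. by rewrite /mass /avoid (bigID (fun A : {set 'I_n} => i \in A))/= addrK. Qed.

(* [a] and [e] are the mass avoiding and the entropy of a coordinate. When
   [a < 7/10 z], what remains after bounding [e] is [(2a - z)(7z - 4a) >= 0],
   and [7 ln 5 > 16 ln 2] because [5 ^ 7 > 2 ^ 16]. *)
Lemma coord_gain_ge0 (R : realType) (z a e l : R) :
  z / 2 < a <= z -> 0 <= e <= z * ln 2 -> ln 5 <= 2 * l ->
  0 <= l * (a * (z - a)) - (z - 10 / 7 * a) * e /\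
  (a < z -> 0 < l * (a * (z - a)) - (z - 10 / 7 * a) * e).
Proof.
case/andP=> za az /andP[e0 ez] hl.
have ln2 : 0 < ln 2 :> R by apply: ln_gt0; lra.
have hl2 : 8 / 7 * ln 2 < l.
  have : ln (2 ^+ 16) < ln (5 ^+ 7) :> R.
    by rewrite ltr_ln ?posrE ?exprn_gt0//; lra.
  by rewrite !lnXn// -[ln 2 *+ _]mulr_natl -[ln 5 *+ _]mulr_natl; lra.
have z0 : 0 < z by lra.
have a0 : 0 < a by lra.
have aza : 0 <= a * (z - a) by rewrite mulr_ge0; lra.
have gain : a < z -> 8 / 7 * ln 2 * (a * (z - a)) < l * (a * (z - a)).
  by move=> ltaz; rewrite ltr_pM2r// mulr_gt0; lra.
have gain' : 8 / 7 * ln 2 * (a * (z - a)) <= l * (a * (z - a)).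
  by apply: ler_wpM2r => //; exact: ltW.
suff : (z - 10 / 7 * a) * e <= 8 / 7 * ln 2 * (a * (z - a)).
  by split=> [|/gain]; lra.
have [h|h] := leP (7 / 10 * z) a.
  apply: (@le_trans _ _ 0); last by rewrite mulr_ge0//; lra.
  by rewrite mulr_le0_ge0//; lra.
apply: le_trans (_ : (z - 10 / 7 * a) * (z * ln 2) <= _).
  by apply: ler_wpM2l => //; lra.
have : 0 <= ln 2 * ((2 * a - z) * (7 * z - 4 * a)) :> R.
  by rewrite !mulr_ge0//; lra.
lra.
Qed.

(** * The weighted family: optimality of its product weight and the resulting contradiction *)

Section WeightedFamily.
Variables (R : realType) (n : nat) (x : 'I_n -> R) (F : {set {set 'I_n}}).
Hypotheses (x_gt0 : forall i, 0 < x i) (F_union_closed : union_closed F).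

Let w (A : {set 'I_n}) : R := if A \in F then \prod_(j in A) x j else 0.

Let w_ge0 A : 0 <= w A.
Proof. by rewrite /w; case: ifP => // _; apply: prodr_ge0 => j _; apply: ltW. Qed.

Let w_gt0 A : A \in F -> 0 < w A.
Proof. by move=> AF; rewrite /w AF; apply: prodr_gt0 => j _. Qed.

(** On the family [ln (w A)] is a sum over the elements of [A], and the two sums are exchanged. Off
    the family [g] vanishes, so the default value of [ln 0] does no harm. *)
Lemma sum_mul_ln_weight (g : {set 'I_n} -> R) :
  (forall A, A \notin F -> g A = 0) ->
  \sum_A g A * ln (w A) = \sum_i ln (x i) * (mass g - avoid g i).
Proof.
move=> gF.
under [RHS]eq_bigr do rewrite sum_subr_avoid big_distrr/= big_mkcond.
rewrite exchange_big; apply: eq_bigr => A _ /=.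
have [AF|/gF g0] := boolP (A \in F); last first.
  by rewrite g0 mul0r big1// => i _; rewrite mulr0 if_same.
rewrite /w AF ln_prod// big_distrr/= [LHS]big_mkcond.
by apply: eq_bigr => i _; rewrite mulrC.
Qed.

(* Among all measures of given mass carried by the family, [w] maximizes entropy
   plus mean logarithmic weight. The law of the union of two independent sets
   distributed as [w] is carried by the family and cannot do better. *)
Lemma entropy_union_weight_le :
  \sum_i ln (x i) * (mass w ^+ 2 - avoid w i ^+ 2) + entropy (union_conv w w)
    <= mass w * (\sum_i ln (x i) * (mass w - avoid w i) + entropy w).
Proof.
set G := union_conv w w; set Z := mass w.
have wF A : A \notin F -> w A = 0 by rewrite /w => /negbTE->.
(* Union-closedness enters here: the convolution is carried by [F]. *)
have GF C : C \notin F -> G C = 0.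
  move=> CF; rewrite /G /union_conv big1// => A _; rewrite big1// => B /eqP CE.
  have [AF|/wF->] := boolP (A \in F); last by rewrite mul0r.
  have [BF|/wF->] := boolP (B \in F); last by rewrite mulr0.
  by rewrite -CE F_union_closed in CF.
have mG : mass G = Z ^+ 2 by rewrite mass_union_conv.
have -> : \sum_i ln (x i) * (Z ^+ 2 - avoid w i ^+ 2) = \sum_A G A * ln (w A).
  rewrite sum_mul_ln_weight// mG; apply: eq_bigr => i _.
  by rewrite avoid_union_conv.
rewrite -sum_mul_ln_weight//.
have [Z0|ZN0] := eqVneq Z 0.
  have w0 A : w A = 0 by apply: (psumr_eq0P (fun A _ => w_ge0 A) Z0).
  have G0 A : G A = 0.
    by rewrite /G /union_conv big1// => B _; rewrite big1// => C _; rewrite w0 mul0r.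
  rewrite Z0 mul0r /entropy mG Z0 !big1 => [|A _|A _];
    rewrite ?G0 /xlnx_neg ?mul0r ?oppr0//.
  by rewrite expr2 !mul0r oppr0 subr0 addr0.
have Z0 : 0 < Z by rewrite lt_neqAle eq_sym ZN0 mass_ge0.
(* Gibbs' inequality for [G] against [w]. As [G] has mass [Z ^+ 2], the comparison is with [w]
   scaled by [Z], which explains the factor [mass w] in the conclusion. *)
have gibbs := @sum_mul_ln_ratio_le R _ G w (union_conv_ge0 w_ge0 w_ge0) w_ge0 _.
have {gibbs} : \sum_A G A * (ln (w A) - ln (G A)) <= Z ^+ 2 * (ln Z - ln (Z ^+ 2)).
  rewrite -mG; apply: gibbs => A wA0; apply: GF; apply/negP => /w_gt0.
  by rewrite wA0 ltxx.
under eq_bigr do rewrite mulrBr.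
rewrite sumrB lnXn// /entropy mG -/Z /xlnx_neg lnXn// !sumrN => h.
have -> : \sum_A w A * ln (w A) + (- (\sum_A w A * ln (w A)) - - (Z * ln Z)) =
  Z * ln Z by ring.
lra.
Qed.

(** By contradiction: if every element of the union has frequency below 1/2, each coordinate has a
    nonnegative gain and some coordinate a positive one, against the optimality of [w]. *)
Lemma weighted_union_closed :
  (forall i, 5 <= x i ^+ 2) -> F != set0 -> F != [set set0] ->
  exists2 i, i \in \bigcup_(A in F) A &
    \sum_(A in F) \prod_(j in A) x j <=
    2 * \sum_(A in F | i \in A) \prod_(j in A) x j.
Proof.
move=> x5 F0 F1.
have lnx i : ln 5 <= 2 * ln (x i).
  by rewrite mulr_natl -lnXn// ler_ln ?posrE// exprn_gt0.
have massE : mass w = \sum_(A in F) \prod_(j in A) x j by rewrite [RHS]big_mkcond.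
have memE i : mass w - avoid w i = \sum_(A in F | i \in A) \prod_(j in A) x j.
  by rewrite sum_subr_avoid big_mkcondl.
have [|nex] := boolP [exists i, (i \in \bigcup_(A in F) A) &&
    (\sum_(A in F) \prod_(j in A) x j <=
      2 * \sum_(A in F | i \in A) \prod_(j in A) x j)].
  by case/existsP=> i /andP[]; exists i.
have [A0 A0F A0N] : exists2 A, A \in F & A != set0.
  have [A AF] := set0Pn _ F0.
  have [A0|] := eqVneq A set0; last by exists A.
  apply/exists_inP; apply: contraNT F1 => /exists_inPn nA.
  rewrite eqEsubset sub1set -{2}A0 AF andbT; apply/subsetP => B /nA.
  by rewrite negbK inE.
have [i0 i0A] := set0Pn _ A0N.
have Z0 : 0 < mass w.
  rewrite /mass (bigD1 A0)//= ltr_wpDr ?w_gt0//.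
  by apply: sumr_ge0 => A _; apply: w_ge0.
have avoid_le i : avoid w i <= mass w.
  by rewrite -subr_ge0 sum_subr_avoid; apply: sumr_ge0 => A _; apply: w_ge0.
(* This covers all coordinates: one outside the union is avoided by the whole mass, which is
   positive. *)
have avoid_gt i : mass w / 2 < avoid w i.
  have [iF|iF] := boolP (i \in \bigcup_(A in F) A); last first.
    suff : mass w - avoid w i = 0 by lra.
    rewrite memE big_pred0// => A; apply/negbTE/negP => /andP[AF iA].
    by move/negP: iF; apply; apply/bigcupP; exists A.
  move: nex; rewrite negb_exists => /forallP/(_ i).
  by rewrite iF /= -ltNge -massE -memE; lra.
(* The member [A0] contains [i0] and has positive weight; this makes the total gain strict. *)
have i0_lt : avoid w i0 < mass w.
  rewrite -subr_gt0 sum_subr_avoid (bigD1 A0)//= ltr_wpDr ?w_gt0//.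
  by apply: sumr_ge0 => A _; apply: w_ge0.
have gain i := @coord_gain_ge0 R (mass w) (avoid w i) (coord_entropy i w) (ln (x i)).
have {}gain i := gain i ltac:(by rewrite avoid_gt avoid_le)
  ltac:(by rewrite coord_entropy_ge0// coord_entropy_le) (lnx i).
have : 0 < \sum_(i < n) (ln (x i) * (avoid w i * (mass w - avoid w i))
                   - (mass w - 10 / 7 * avoid w i) * coord_entropy i w).
  rewrite (bigD1 i0)//= ltr_wpDr//; last by apply: (gain i0).2.
  by apply: sumr_ge0 => i _; apply: (gain i).1.
have le1 := entropy_union_weight_le.
have le2 := entropy_union_conv_ge w_ge0 w_ge0.
rewrite (entropy_coord w) in le1.
(* With [Z] the mass and [a] the avoiding mass, [Z^2 - a^2 - Z (Z - a) = a (Z - a)]. The total gain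
   is thus the quantity that [le1] and [le2] force to be at most 0. *)
suff -> : \sum_(i < n) (ln (x i) * (avoid w i * (mass w - avoid w i))
                   - (mass w - 10 / 7 * avoid w i) * coord_entropy i w) =
  \sum_i ln (x i) * (mass w ^+ 2 - avoid w i ^+ 2)
  + 5 / 7 * \sum_(i < n) (avoid w i * coord_entropy i w + avoid w i * coord_entropy i w)
  - mass w * (\sum_i ln (x i) * (mass w - avoid w i) + \sum_(i < n) coord_entropy i w).
  lra.
rewrite mulrDr !mulr_sumr -!big_split/= -sumrB.
by apply: eq_bigr => i _; field.
Qed.

End WeightedFamily.

(** * Transfer from the reals to an arbitrary real closed field *)

Theorem theorem1p2 (R : rcfType) (n : nat) (hn : (1 <= n)%N)
    (k m : 'I_n -> nat)
    (hk : forall i : 'I_n, (5 <= k i)%N)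
    (hm : forall i : 'I_n,
        (1 <= m i)%N /\ (m i)%:R <= Num.sqrt (k i)%:R :> R)
    (F : {set {set 'I_n}})
    (hF : union_closed F) (hF0 : F != set0) (hF1 : F != [set set0]) :
  exists2 i : 'I_n, i \in \bigcup_(A in F) A &
    (\sum_(A in F | i \in A) \prod_(j in A) ((k j)%:R / (m j)%:R)) /
    (\sum_(A in F) \prod_(j in A) ((k j)%:R / (m j)%:R)) >= 1 / 2 :> R.
Proof.
have m_gt0 i : (0 < m i)%N by have [] := hm i.
have k_gt0 i : (0 < k i)%N by apply: leq_trans (hk i).
(* Squaring turns the bound on [m] into one between natural numbers, usable in every ordered
   field. *)
have mk i : (m i ^ 2 <= k i)%N.
  have [_ h] := hm i; rewrite -(ler_nat R) natrX -(sqr_sqrtr (ler0n R (k i))).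
  by rewrite ler_pXn2r// nnegrE ?sqrtr_ge0.
(* The weights are taken in a variable field: the sums over [R] and over the reals are images of the
   same rational sums, and [ratr] preserves and reflects order. *)
pose x (K : fieldType) (j : 'I_n) : K := (k j)%:R / (m j)%:R.
have ratr_sum (K : numFieldType) (P : pred {set 'I_n}) :
    \sum_(A | P A) \prod_(j in A) x K j
      = ratr (\sum_(A | P A) \prod_(j in A) x rat j).
  rewrite rmorph_sum; apply: eq_bigr => A _; rewrite rmorph_prod.
  by apply: eq_bigr => j _; rewrite /x fmorph_div !rmorph_nat.
have ratr_le2 (K : numFieldType) (a b : rat) :
    (ratr a <= 2 * ratr b :> K) = (a <= 2 * b).
  by rewrite -(ler_rat K) rmorphM/= ratr_nat.
have x_gt0 (K : numFieldType) j : 0 < x K j by rewrite divr_gt0 ?ltr0n.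
(* [k^2 / m^2 >= k >= 5], since [m^2 <= k]. *)
have x_sqr (K : numFieldType) j : 5 <= x K j ^+ 2.
  rewrite expr_div_n -!natrX ler_pdivlMr ?ltr0n ?expn_gt0 ?m_gt0// -natrM ler_nat.
  by rewrite -[(k j ^ 2)%N]mulnn leq_mul.
have [i iF] := @weighted_union_closed Rdefinitions.R n (x _) F (x_gt0 _) hF
  (x_sqr _) hF0 hF1.
rewrite !(ratr_sum Rdefinitions.R) ratr_le2 => hi.
exists i => //.
have S_gt0 : 0 < \sum_(A in F) \prod_(j in A) x R j.
  have [A AF] := set0Pn _ hF0.
  have prod_gt0 (B : {set 'I_n}) : 0 < \prod_(j in B) x R j.
    by apply: prodr_gt0 => j _; apply: x_gt0.
  rewrite (bigD1 A)//= ltr_pwDl//.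
  by apply: sumr_ge0 => B _; apply: ltW.
rewrite ler_pdivlMr// mul1r ler_pdivrMl// !(ratr_sum R).
by rewrite ratr_le2.
Qed.
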